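(* Let $\mathfrak{A}$ be a unital $C^*$-algebra and $a,b\in\mathfrak{A}$. Then $$dw_{\mathfrak{A}}(a+b)\leq dw_{\mathfrak{A}}(a)+dw_{\mathfrak{A}}(b)+\|a^*b+b^*a\|.$$
   Context: $\mathfrak{A}$ is a complex, nonzero, unital $C^*$-algebra with unit $\boldsymbol{1}$; its state space $\mathfrak{S}(\mathfrak{A})$ is the set of all positive linear functionals $f\in\mathfrak{A}^*$ with $\|f\|=f(\boldsymbol{1})=1$. The algebraic Davis--Wielandt radius of $a\in\mathfrak{A}$ is $dw_{\mathfrak{A}}(a)=\sup\{\sqrt{|f(a)|^2+f(a^*a)^2}:f\in\mathfrak{S}(\mathfrak{A})\}$. *)

(* Defs.v *)
From HB Require Import structures.
From mathcomp Require Import all_boot all_order all_algebra.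
From mathcomp Require Import all_classical all_reals all_analysis.
From mathcomp Require Import complex.

Set Implicit Arguments.
Unset Strict Implicit.
Unset Printing Implicit Defensive.

Import Order.TTheory GRing.Theory Num.Theory.
Import numFieldNormedType.Exports ComplexField.Normc.

Local Open Scope classical_set_scope.
Local Open Scope ring_scope.

(* Unital, nonzero complex C*-algebras: an [algType] has a unit and [1 != 0].
   The norm is a field of the mixin, with values in [R], because MathComp has
   no join of its rings with its normed modules (and a MathComp norm over
   [R[i]] would take its values in [R[i]]). *)
HB.mixin Record isCStarAlgebra (R : realType) A of GRing.Algebra R[i] A := {
  cnorm : A -> R ;
  star : A -> A ;
  cnormD_le : forall x y : A, cnorm (x + y) <= cnorm x + cnorm y ;
  cnormZ : forall (c : R[i]) (x : A), cnorm (c *: x) = normc c * cnorm x ;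
  cnorm_eq0 : forall x : A, cnorm x = 0 -> x = 0 ;
  cnormM_le : forall x y : A, cnorm (x * y) <= cnorm x * cnorm y ;
  cnorm_complete : forall u : nat -> A,
    (forall e : R, 0 < e -> exists N : nat, forall m n : nat,
       (N <= m)%N -> (N <= n)%N -> cnorm (u m - u n) < e) ->
    exists l : A, cnorm (u n - l) @[n --> \oo] --> (0 : R) ;
  starK : involutive star ;
  starD : {morph star : x y / x + y} ;
  starZ : forall (c : R[i]) (x : A), star (c *: x) = conjc c *: star x ;
  starM : forall x y : A, star (x * y) = star y * star x ;
  cnorm_starM : forall x : A, cnorm (star x * x) = cnorm x ^+ 2 }.

#[short(type="cstarAlgType")]
HB.structure Definition CStarAlgebra (R : realType) :=
  {A of GRing.Algebra R[i] A & isCStarAlgebra R A}.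

Section DavisWielandt.
Variables (R : realType) (A : cstarAlgType R).

Definition bounded_functional (f : {scalar A}) : Prop :=
  exists M : R, forall x : A, normc (f x) <= M * cnorm x.

Definition dual_norm (f : {scalar A}) : R :=
  sup [set normc (f x) | x in [set x : A | cnorm x <= 1]].

(* On [R[i]], [0 <= z] means that [z] is real and nonnegative. *)
Definition positive_functional (f : {scalar A}) : Prop :=
  forall x : A, 0 <= f (star x * x).

Definition state_space : set {scalar A} :=
  [set f | [/\ bounded_functional f, positive_functional f,
               dual_norm f = 1 & f 1 = 1]].

(* For a state [f], [f (star a * a)] is a nonnegative real number, so its real
   part is that number seen in [R]. *)
Definition dw (a : A) : R :=
  sup [set Num.sqrt (normc (f a) ^+ 2 + complex.Re (f (star a * a)) ^+ 2)
      | f in state_space].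

End DavisWielandt.

(* Main.v *)
(** For a state [f], put [z(x) = |f(x)| + i f(x^* x)], so that [dw x] is the
    supremum of [|z(x)|].  With [c = a^* b + b^* a], both coordinates of
    [z(a + b)] are nonnegative and at most those of [z(a) + z(b) + i |Re f(c)|],
    and [|f(c)| <= cnorm c]; the triangle inequality in the complex plane
    concludes. *)
Require Import Defs.
From mathcomp Require Import all_boot all_order all_algebra.
From mathcomp Require Import all_classical all_reals all_analysis.
From mathcomp Require Import complex.
Import Order.TTheory GRing.Theory Num.Theory.
Import ComplexField.Normc.
Local Open Scope ring_scope.

Set Implicit Arguments.
Unset Strict Implicit.

Lemma cnorm0 (R : realType) (A : cstarAlgType R) : cnorm (0 : A) = 0.
Proof. by rewrite -(scale0r (0 : A)) cnormZ normc0 mul0r. Qed.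

(** The triangle inequality for [x] and [-x] gives [0 <= 2 * cnorm x]. *)
Lemma cnorm_ge0 (R : realType) (A : cstarAlgType R) (x : A) : 0 <= cnorm x.
Proof.
have := cnormD_le x (-1 *: x).
rewrite cnormZ scaleN1r subrr cnorm0 normcN normc1 mul1r -mulr2n.
by rewrite pmulrn_lge0.
Qed.

Lemma normc_real (R : realType) (r : R) : 0 <= r -> normc (real_complex R r) = r.
Proof. by move=> r0; rewrite /normc/= expr0n addr0 sqrtr_sqr ger0_norm. Qed.

Lemma abs_Re_le_normc (R : realType) (z : R[i]) : `|complex.Re z| <= normc z.
Proof.
case: z => x y; rewrite /normc/= -sqrtr_sqr ler_sqrt ?lerDl ?sqr_ge0//.
by rewrite addr_ge0 ?sqr_ge0.
Qed.

(** For [x] nonzero, rescale to the unit vector [c *: x]; boundedness of [f] makes the supremum an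
    actual upper bound. *)
Lemma normc_le_dual_norm (R : realType) (A : cstarAlgType R) (f : {scalar A})
    (x : A) :
  bounded_functional f -> normc (f x) <= dual_norm f * cnorm x.
Proof.
move=> [M fM]; have [/cnorm_eq0 ->|x0] := eqVneq (cnorm x) 0.
  by rewrite linear0 normc0 cnorm0 mulr0.
have x_gt0 : 0 < cnorm x by rewrite lt0r x0 cnorm_ge0.
pose c := real_complex R (cnorm x)^-1.
have cE : normc c = (cnorm x)^-1 by rewrite normc_real// invr_ge0 ltW.
have -> : normc (f x) = normc (f (c *: x)) * cnorm x.
  by rewrite linearZ/= normcM cE mulrAC mulVf// mul1r.
rewrite ler_pM2r//; apply: ub_le_sup; last first.
  by exists (c *: x) => //=; rewrite cnormZ cE mulVf.
(* The sign of [M] is not given, so [M * cnorm y <= M] could not be read off from [cnorm y <= 1];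
   with the absolute value it can. *)
exists `|M| => _ [y /= y1 <-]; apply: (le_trans (fM y)).
apply: (@le_trans _ _ (`|M| * cnorm y)).
  by rewrite ler_wpM2r ?cnorm_ge0 ?ler_norm.
by rewrite ler_piMr.
Qed.

Lemma state_contractive (R : realType) (A : cstarAlgType R) (f : {scalar A})
    (x : A) :
  state_space f -> normc (f x) <= cnorm x.
Proof.
by move=> [fb _ f1 _]; have := normc_le_dual_norm x fb; rewrite f1 mul1r.
Qed.

Lemma ge0_Re (R : realType) (z : R[i]) : 0 <= z -> 0 <= complex.Re z.
Proof. by rewrite lecE/= => /andP[]. Qed.

Lemma ler_hypot (R : realType) (u v u' v' : R) :
  0 <= u <= u' -> 0 <= v <= v' ->
  Num.sqrt (u ^+ 2 + v ^+ 2) <= Num.sqrt (u' ^+ 2 + v' ^+ 2).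
Proof.
move=> /andP[u0 uu'] /andP[v0 vv'].
rewrite ler_sqrt ?addr_ge0 ?sqr_ge0//.
rewrite lerD//; first by rewrite ler_pXn2r ?nnegrE ?(le_trans u0).
by rewrite ler_pXn2r ?nnegrE ?(le_trans v0).
Qed.

Lemma normc_ge0 (R : realType) (z : R[i]) : 0 <= normc z.
Proof. by case: z => x y; rewrite sqrtr_ge0. Qed.

(** The point is that the set under the supremum is bounded above: states are contractive, which
    bounds both coordinates uniformly in the state. *)
Lemma le_dw (R : realType) (A : cstarAlgType R) (a : A) (f : {scalar A}) :
  state_space f ->
  Num.sqrt (normc (f a) ^+ 2 + complex.Re (f (star a * a)) ^+ 2) <= dw a.
Proof.
move=> fS; apply: ub_le_sup; last by exists f.
exists (Num.sqrt (cnorm a ^+ 2 + cnorm (star a * a) ^+ 2)) => _ [g gS <-].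
apply: ler_hypot; first by rewrite normc_ge0 state_contractive.
have [_ gpos _ _] := gS; rewrite ge0_Re//=.
exact: le_trans (ler_norm _) (le_trans (abs_Re_le_normc _) (state_contractive _ gS)).
Qed.

Lemma dw_ge0 (R : realType) (A : cstarAlgType R) (a : A) : 0 <= dw a.
Proof.
have [[f fS]|/set0P/negP/negPn/eqP S0] := pselect (@state_space R A !=set0)%classic.
  exact: le_trans (sqrtr_ge0 _) (le_dw a fS).
by rewrite /dw S0 image_set0 sup0.
Qed.

Theorem theorem3p17 (R : realType) (A : cstarAlgType R) (a b : A) :
  dw (a + b) <= dw a + dw b + cnorm (star a * b + star b * a).
Proof.
have [S0|S0] := pselect (@state_space R A !=set0)%classic; last first.
  have {}S0 : @state_space R A = set0 by apply/eqP/negPn/negP => /set0P.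
  (* [sup set0 = 0], so the existence of states is not needed. *)
  rewrite {1}/dw S0 image_set0 sup0.
  by rewrite !addr_ge0 ?dw_ge0 ?cnorm_ge0.
apply: ge_sup => [|_ [f fS <-]].
  by case: S0 => f fS; eexists; exists f.
set c := star a * b + star b * a.
have [_ fpos _ _] := fS.
have fD : f (star (a + b) * (a + b)) = f (star a * a) + f (star b * b) + f c.
  rewrite -!linearD starD mulrDl !mulrDr /c -!addrA; congr (f (_ + _)).
  by rewrite [RHS]addrC -!addrA; congr (_ + _); rewrite addrC.
pose z (x : A) : R[i] := Complex (normc (f x)) (complex.Re (f (star x * x))).
pose w : R[i] := Complex 0 `|complex.Re (f c)|.
(* [normc (z x)] unfolds to the square root that defines [dw x]. *)
have zE x : normc (z x) <= dw x by exact: le_dw.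
have wE : normc w <= cnorm c.
  rewrite /w/= expr0n add0r sqrtr_sqr normr_id.
  exact: le_trans (abs_Re_le_normc _) (state_contractive _ fS).
apply: (@le_trans _ _ (normc (z a + z b + w))); last first.
  apply: le_trans (le_normcD _ _) _; rewrite lerD//.
  by apply: le_trans (le_normcD _ _) _; rewrite lerD.
(* Both moduli are now square roots of sums of squares, compared coordinate by coordinate. *)
rewrite /= addr0; apply: ler_hypot.
  by rewrite normc_ge0/= linearD le_normcD.
(* Squaring preserves the order only between nonnegative numbers; positivity of [f] at [a + b]
   supplies the lower bound. *)
rewrite ge0_Re//= fD.
case: (f (star a * a)) (f (star b * b)) (f c) => [? ?] [? ?] [? ?] /=.
by rewrite lerD2l ler_norm.
Qed.
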